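(* Let $(X,\Sigma,\mu)$ be a measure space with a non-negative, non-atomic, finite measure $\mu$, and let $W\in L_1(X,\mu)$ be a non-negative function on $X$. Then for every $\theta>1$ and every $t\in(0,\mu(X))$ $$J_W\big(\mu(X)-t/\theta,\,X,\,\mu\big)\ \ge\ \frac{(\theta-1)t}{\theta}\,\bar W^\star(t,X,\mu),$$ $$J_W\big(\mu(X)-t,\,X,\,\mu\big)\ \le\ (\mu(X)-t)\,\bar W^\star(t,X,\mu).$$
   Context: The non-decreasing rearrangement of $W$ is $W_\star(t,X,\mu)=\sup\{s>0:\ \mu(\{x\in X: W(x)\le s\})<t\}$ for $t>0$, and $$\mathcal{K}_W^-(t,X,\mu)=\{x\in X:\ W(x)<W_\star(t,X,\mu)\},\qquad \kappa_W^-(t,X,\mu)=\mu(\mathcal{K}_W^-(t,X,\mu)),$$ $$J_W(t,X,\mu)=\int_{\mathcal{K}_W^-(t,X,\mu)}W(x)\,\mu(\mathrm{d}x)+\big(t-\kappa_W^-(t,X,\mu)\big)\,W_\star(t,X,\mu).$$ The non-increasing rearrangement of $W$ is $$\bar W^\star(t,X,\mu)=\sup\{s>0:\ \mu(\{x\in X: W(x)\ge s\})\ge t\}\quad(t>0).$$ In both rearrangements $\sup\emptyset=0$. *)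

(* Defs.v *)
From HB Require Import structures.
From mathcomp Require Import all_boot all_order all_algebra.
From mathcomp Require Import all_classical all_reals all_analysis.

Set Implicit Arguments.
Unset Strict Implicit.
Unset Printing Implicit Defensive.

Import Order.TTheory GRing.Theory Num.Theory.
Local Open Scope classical_set_scope.
Local Open Scope ring_scope.
Local Open Scope ereal_scope.

(* Unlike [reals.sup], which is 0 on unbounded sets, this supremum is +oo there;
   unlike [ereal_sup], it is 0 on the empty set. *)
Definition esup0 (R : realType) (S : set R) : \bar R :=
  if S == set0 then 0 else ereal_sup (EFin @` S).

Definition nonatomic d (X : measurableType d) (R : realType)
    (mu : set X -> \bar R) : Prop :=
  forall A : set X, measurable A -> 0 < mu A ->
    exists B : set X, [/\ measurable B, B `<=` A, 0 < mu B & mu B < mu A].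

Section rearrangement.
Context d (X : measurableType d) (R : realType).
Variables (mu : {finite_measure set X -> \bar R}) (W : X -> R).

Definition nondecr_rearr (t : R) : \bar R :=
  esup0 [set s : R | (0 < s)%R /\ mu [set x | (W x <= s)%R] < t%:E].

Definition nonincr_rearr (t : R) : \bar R :=
  esup0 [set s : R | (0 < s)%R /\ t%:E <= mu [set x | (s <= W x)%R]].

Definition Kminus (t : R) : set X :=
  [set x | (W x)%:E < nondecr_rearr t].

Definition kappaminus (t : R) : \bar R := mu (Kminus t).

Definition Jfun (t : R) : \bar R :=
  \int[mu]_(x in Kminus t) (W x)%:E
  + (t%:E - kappaminus t) * nondecr_rearr t.

End rearrangement.

(* Main.v *)
(** Let [M] be the total mass, [w] the value of the non-decreasing rearrangement
    at [a], and [b] that of the non-increasing one at [t]. Everything rests on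
    [mu {W < w} <= a], which makes the second term of [J_W] non-negative. For
    [a = M - t], bounding [W] by [w] on [{W < w}] gives [J_W a <= a w], and
    [w <= b] by complementation. For [a = M - t / theta], each [s] admissible in
    the definition of [b] satisfies [s <= w]; discarding the part of [{W < w}]
    where [W < s], of measure at most [M - t], yields
    [J_W a >= (a - (M - t)) s = (t - t / theta) s]. *)
Require Import Defs.
From mathcomp Require Import all_boot all_order all_algebra.
From mathcomp Require Import all_classical all_reals all_analysis.
From mathcomp Require Import measurable_realfun lra.

Set Implicit Arguments.
Unset Strict Implicit.
Unset Printing Implicit Defensive.

Import Order.TTheory GRing.Theory Num.Theory.

Local Open Scope classical_set_scope.
Local Open Scope ring_scope.
Local Open Scope ereal_scope.

Section esup0.
Context (R : realType).
Implicit Types (S : set R) (s : R) (y : \bar R).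

Lemma le_esup0 S s : S s -> s%:E <= esup0 S.
Proof.
move=> Ss; rewrite /esup0; case: ifPn => [/eqP S0|_]; first by rewrite S0 in Ss.
by apply: ereal_sup_ubound; exists s.
Qed.

(** The bound [0 <= y] pays for the value 0 that [esup0] takes on the empty set. *)
Lemma esup0_le S y : 0 <= y -> (forall s, S s -> s%:E <= y) -> esup0 S <= y.
Proof.
move=> y0 Sy; rewrite /esup0; case: ifPn => // _.
by apply: ge_ereal_sup => _ [s Ss <-]; exact: Sy.
Qed.

Lemma esup0_ge0 S : (forall s, S s -> (0 <= s)%R) -> 0 <= esup0 S.
Proof.
move=> S0; have [->|/set0P[s Ss]] := eqVneq S set0; first by rewrite /esup0 eqxx.
by apply: le_trans (le_esup0 Ss); rewrite lee_fin S0.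
Qed.

Lemma esup0_seq S : S !=set0 ->
  {s : nat -> R | forall i, S (s i) & (s i)%:E @[i --> \oo] --> esup0 S}.
Proof.
move=> /set0P S0; rewrite /esup0 (negbTE S0).
have ES0 : EFin @` S != set0.
  by move/set0P: S0 => [s Ss]; apply/set0P; exists s%:E; exists s.
have [u uS ucvg] := ereal_sup_seq ES0.
have uE i : u i = (fine (u i))%:E by case: (uS i) => s _ <-.
exists (fine \o u) => [i|]; first by case: (uS i) => s Ss /= <-.
by under eq_fun do rewrite /= -uE.
Qed.

End esup0.

Section rearrangement.
Context d (X : measurableType d) (R : realType).
Variables (mu : {finite_measure set X -> \bar R}) (W : X -> R).
Hypothesis mW : measurable_fun setT W.
Hypothesis W_ge0 : forall x, (0 <= W x)%R.

Let measurable_sublevel s : measurable [set x | (W x <= s)%R].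
Proof.
rewrite -[X in measurable X]setTI.
exact: measurable_fun_le.
Qed.

Let measurable_superlevel s : measurable [set x | (s <= W x)%R].
Proof.
rewrite -[X in measurable X]setTI.
exact: measurable_fun_le.
Qed.

Let mEW : measurable_fun [set: X] (fun x => (W x)%:E).
Proof. exact/measurable_EFinP. Qed.

Lemma measurable_Kminus a : measurable (Kminus mu W a).
Proof.
rewrite -[X in measurable X]setTI.
exact: emeasurable_fun_infty_o.
Qed.

Lemma nondecr_rearr_ge0 a : 0 <= nondecr_rearr mu W a.
Proof. by apply: esup0_ge0 => s [/ltW]. Qed.

Lemma nonincr_rearr_ge0 a : 0 <= nonincr_rearr mu W a.
Proof. by apply: esup0_ge0 => s [/ltW]. Qed.

(* [Kminus mu W a] is the union of the sublevel sets [W <= s i] for a sequence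
   [s] in the defining set converging to its supremum, and finite unions of them
   are sublevel sets again. *)
Lemma kappaminus_le a : (0 <= a)%R -> kappaminus mu W a <= a%:E.
Proof.
move=> a0; rewrite /kappaminus.
set S := [set s : R | (0 < s)%R /\ mu [set x | (W x <= s)%R] < a%:E].
have [S0|/set0P S0] := eqVneq S set0.
  (* With no admissible threshold the rearrangement is 0, and [W < 0] holds nowhere. *)
  rewrite (_ : Kminus mu W a = set0) ?measure0 ?lee_fin//.
  apply/seteqP; split=> // x; rewrite /Kminus /nondecr_rearr -/S S0 /esup0 eqxx/=.
  by rewrite lte_fin ltNge W_ge0.
have [s Ss scvg] := esup0_seq S0.
pose G i := [set x | (W x <= s i)%R].
pose F n := \big[setU/set0]_(i < n) G i.
have mF n : measurable (F n) by apply: bigsetU_measurable => i _; exact: measurable_sublevel.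
have muF n : mu (F n) <= a%:E.
  (* One threshold of [S] dominates the first [n] terms: their maximum, which stays in [S]. For the
     empty union any element of [S] will do. *)
  suff [r [_ /ltW ra] Fr] : exists2 r, S r & F n `<=` [set x | (W x <= r)%R].
    by apply: le_trans ra; apply: le_measure => //; rewrite inE.
  elim: n => [|n [r Sr Fr]]; first by exists (s 0%N) => //; rewrite /F big_ord0.
  exists (Num.max r (s n)); first by rewrite /Num.max; case: ifP.
  rewrite /F big_ord_recr/= => x [/Fr|]; rewrite /G/= le_max => -> //.
  by rewrite orbT.
have KF : Kminus mu W a `<=` \bigcup_n F n.
  move=> x; rewrite /Kminus/= => Wx.
  (* A point outside every [F n] has [s i <= W x] for all [i]; in the limit [W x] bounds the
     supremum, contradicting [Kminus]. *)
  apply: contrapT => nF; move: Wx; apply/negP; rewrite -leNgt.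
  rewrite /nondecr_rearr -/S -(cvg_lim _ scvg)//.
  apply: lime_le; first exact: (cvgP _ scvg).
  near=> i; rewrite lee_fin leNgt; apply/negP => /ltW Wsi.
  by apply: nF; exists i.+1 => //; rewrite /F big_ord_recr; right.
have mUF : measurable (\bigcup_n F n) by exact: bigcup_measurable.
apply: (@le_trans _ _ (mu (\bigcup_n F n))).
  by apply: le_measure => //; rewrite inE//; exact: measurable_Kminus.
have Fcvg : mu (F n) @[n --> \oo] --> mu (\bigcup_n F n).
  by apply: nondecreasing_cvg_mu => //; move=> n m nm; exact/subsetPset/subset_bigsetU.
rewrite -(cvg_lim _ Fcvg)//; apply: lime_le; first exact: (cvgP _ Fcvg).
by near=> n; exact: muF.
Unshelve. all: by end_near. Qed.

Let mu_fin A : measurable A -> mu A \is a fin_num.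
Proof. exact: fin_num_measure. Qed.

(** The sets [W <= s] and [s <= W] cover the space, so if the first has measure below [M - t], the
    second has measure above [t]. *)
Lemma nondecr_le_nonincr_rearr t : t%:E <= mu setT ->
  nondecr_rearr mu W (fine (mu setT) - t) <= nonincr_rearr mu W t.
Proof.
move=> tM; apply: esup0_le; first exact: nonincr_rearr_ge0.
move=> s [s0 muWs]; apply: le_esup0; split=> //.
have : (fine (mu setT))%:E <=
    mu [set x | (W x <= s)%R] + mu [set x | (s <= W x)%R].
  rewrite fineK ?mu_fin//.
  apply: le_trans (measureU2 _ _ _) => //.
  apply: le_measure; rewrite ?inE//; first exact: measurableU.
  by move=> x _ /=; case: (leP (W x) s) => [|/ltW]; [left|right].
move: muWs; rewrite -(fineK (mu_fin (measurable_sublevel s))).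
rewrite -(fineK (mu_fin (measurable_superlevel s))).
rewrite -EFinD !lee_fin lte_fin.
lra.
Qed.

(* The strict gap [r < t] is essential: where the distribution function of [W]
   is flat, [nonincr_rearr mu W t] may exceed [nondecr_rearr mu W (M - t)]. *)
Lemma superlevel_le_nondecr_rearr (r t s : R) : (r < t)%R -> (0 < s)%R ->
    t%:E <= mu [set x | (s <= W x)%R] ->
  s%:E <= nondecr_rearr mu W (fine (mu setT) - r).
Proof.
move=> rt s0 ts; apply/lee_subgt0Pr => e e0; rewrite -EFinB.
(* Only a positive [s - e] can be admissible. It then is, because [W <= s - e] is disjoint from
   [s <= W] and so has measure at most [M - t < M - r]. *)
have [se|se] := leP (s - e)%R 0%R.
  by apply: le_trans (nondecr_rearr_ge0 _); rewrite lee_fin.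
apply: le_esup0; split=> //.
have : mu [set x | (W x <= s - e)%R] + mu [set x | (s <= W x)%R] <=
    (fine (mu setT))%:E.
  rewrite fineK ?mu_fin//.
  rewrite -measureU//.
    by apply: le_measure; rewrite ?inE//; exact: measurableU.
  by rewrite -subset0 => x [/= ? ?]; lra.
move: ts; rewrite -(fineK (mu_fin (measurable_sublevel (s - e)%R))).
rewrite -(fineK (mu_fin (measurable_superlevel s))).
rewrite -EFinD !lee_fin lte_fin.
lra.
Qed.

Lemma Jfun_ge0 a : (0 <= a)%R -> 0 <= Jfun mu W a.
Proof.
move=> a0; rewrite /Jfun adde_ge0 ?mule_ge0 ?nondecr_rearr_ge0//.
  by apply: integral_ge0 => x _; rewrite lee_fin.
by rewrite sube_ge0 ?kappaminus_le// mu_fin//; exact: measurable_Kminus.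
Qed.

Lemma Jfun_le a : (0 <= a)%R -> Jfun mu W a <= a%:E * nondecr_rearr mu W a.
Proof.
move=> a0; have mK := measurable_Kminus a.
rewrite /Jfun; set w := nondecr_rearr mu W a.
have kfin : kappaminus mu W a \is a fin_num by exact: mu_fin.
apply: (@le_trans _ _ (kappaminus mu W a * w + (a%:E - kappaminus mu W a) * w)).
  rewrite leeD2r// muleC -integral_cst//; apply: ge0_le_integral => //.
  - by move=> x _; rewrite lee_fin.
  - exact: measurable_funTS.
  - by move=> x /ltW.
(* As [w] may be infinite, distributivity relies on both coefficients being non-negative. *)
rewrite -ge0_muleDl; last 2 first.
- exact: measure_ge0.
- by rewrite sube_ge0 ?kappaminus_le// kfin.
by rewrite addeC subeK.
Qed.

Lemma Jfun_ge (r t s : R) : (r < t)%R -> t%:E <= mu setT -> (0 < s)%R ->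
    t%:E <= mu [set x | (s <= W x)%R] ->
  ((t - r) * s)%:E <= Jfun mu W (fine (mu setT) - r).
Proof.
move=> rt tM s0 ts; set a := (fine (mu setT) - r)%R.
have a0 : (0 <= a)%R.
  by move: tM; rewrite -(fineK (mu_fin measurableT)) lee_fin /a; lra.
have sw : s%:E <= nondecr_rearr mu W a by exact: superlevel_le_nondecr_rearr ts.
have mK := measurable_Kminus a; have mG := measurable_superlevel s.
set K := Kminus mu W a in mK *; set G := [set x | _] in ts mG *.
have mKG : measurable (K `&` G) by exact: measurableI.
have kfin : kappaminus mu W a \is a fin_num by exact: mu_fin.
have ka := kappaminus_le a0.
rewrite /Jfun -/K.
apply: (@le_trans _ _ (s%:E * mu (K `&` G) + (a%:E - kappaminus mu W a) * s%:E)).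
  have : mu K <= mu (K `&` G) + mu (~` G).
    apply: le_trans (measureU2 _ _ _) => //; last exact: measurableC.
    apply: le_measure; rewrite ?inE//.
      by apply: measurableU => //; exact: measurableC.
    by move=> x Kx; have [Gx|nGx] := pselect (G x); [left|right].
  have -> : mu (~` G) = mu setT - mu G.
    by rewrite -setTD measureD// ?setTI// ltey_eq mu_fin.
  move: ts ka; rewrite /kappaminus -/K -(fineK (mu_fin mK)) -(fineK (mu_fin mG)).
  rewrite -(fineK (mu_fin mKG)) -(fineK (mu_fin measurableT)).
  rewrite -EFinB -EFinD -EFinB -!EFinM -EFinD !lee_fin => tG ka KG.
  rewrite [X in (_ <= _ + X)%R]mulrC -mulrDr mulrC ler_pM2l// /a.
  lra.
apply: leeD; last by rewrite lee_wpmul2l// sube_ge0// kfin.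
apply: (@le_trans _ _ (\int[mu]_(x in K `&` G) (W x)%:E)).
  rewrite -integral_cst//; apply: ge0_le_integral => //.
  - by move=> x _; rewrite lee_fin ltW.
  - exact: measurable_funTS.
  - by move=> x [_ Gx]; rewrite lee_fin.
apply: ge0_subset_integral => //.
- exact: measurable_funTS.
- by move=> x _; rewrite lee_fin.
Qed.

End rearrangement.

Theorem proposition3p4 (d : measure_display) (X : measurableType d)
    (R : realType) (mu : {finite_measure set X -> \bar R})
    (mu_nonatomic : nonatomic mu)
    (W : X -> R) (W_L1 : W \in Lfun mu 1) (W_ge0 : forall x : X, (0 <= W x)%R)
    (theta : R) (theta_gt1 : (1 < theta)%R)
    (t : R) (t_gt0 : (0 < t)%R) (t_lt : t%:E < mu [set: X]) :
  ((theta - 1) * t / theta)%:E * nonincr_rearr mu W t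
    <= Jfun mu W (fine (mu [set: X]) - t / theta)%R
  /\
  Jfun mu W (fine (mu [set: X]) - t)%R
    <= (fine (mu [set: X]) - t)%:E * nonincr_rearr mu W t.
Proof.
have mW : measurable_fun setT W.
  by move/Lfun1_integrable: W_L1 => /integrableP[/measurable_EFinP].
have Mfin : mu setT \is a fin_num by exact: fin_num_measure.
split; last first.
  have tM : (0 < fine (mu setT) - t)%R by rewrite subr_gt0 -lte_fin fineK.
  apply: le_trans (Jfun_le mu mW W_ge0 (ltW tM)) _.
  by rewrite lee_pmul2l// nondecr_le_nonincr_rearr// ltW.
have rt : (t / theta < t)%R by rewrite ltr_pdivrMr ?ltr_pMr//; lra.
have c0 : (0 < (theta - 1) * t / theta)%R.
  by rewrite divr_gt0 ?mulr_gt0 ?subr_gt0//; lra.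
have cE : ((theta - 1) * t / theta = t - t / theta)%R.
  by rewrite mulrBl mul1r mulrBl mulrAC divff ?mul1r// gt_eqF//; lra.
(* Dividing by the positive constant isolates the supremum, which is then bounded one admissible [s]
   at a time; [Jfun_ge0] settles the case where there is none. *)
rewrite -lee_pdivlMl//; apply: esup0_le.
  rewrite mule_ge0 ?lee_fin ?invr_ge0 ?(ltW c0)// Jfun_ge0//.
  by rewrite subr_ge0 (le_trans (ltW rt))// -lee_fin fineK// ltW.
move=> s [s0 ts]; rewrite lee_pdivlMl// -EFinM cE.
exact: (Jfun_ge mW W_ge0 rt (ltW t_lt) s0 ts).
Qed.
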